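(* Let $\mathscr{C}(\mathbf{x},t)=\sum_{\kappa}t^{\mathrm{lm}(\kappa)}x_{k_1}x_{k_2}\cdots x_{k_\ell}$ and $\mathscr{C}(z,t)=\sum_{\kappa}t^{\mathrm{lm}(\kappa)}q^{k_1+\cdots+k_\ell}z^{\ell}$, where both sums are over all compositions $\kappa=(k_1,\dots,k_\ell)$ (including the empty one) and $\mathrm{lm}(\kappa)$ is the number of local minima of $\kappa$. Then $$\mathscr{C}(\mathbf{x},t)=\prod_{k=1}^{\infty}\frac{1-\sum_{j=k+1}^{\infty}x_j}{1-\sum_{j=k+1}^{\infty}x_j-t\,x_k},$$ $$\mathscr{C}(z,t)=\prod_{k=1}^{\infty}\frac{1-q-zq^{k+1}}{1-q-zq^{k+1}+q^k(q-1)zt},$$ as formal power series in the commuting variables $x_1,x_2,\dots,t$ and $q,z,t$ respectively.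
   Context: A composition is a finite sequence $\kappa=(k_1,\dots,k_\ell)$ of positive integers, $\ell\ge0$. The local minima list of a nonempty composition $\kappa$ is the sequence $\mu=(\mu_1,\dots,\mu_r)$ of entries of $\kappa$ defined recursively: $\mu_1$ is the first entry $k_1$; given $\mu_j$, $\mu_{j+1}$ is the first entry of $\kappa$ after (the position of) $\mu_j$ that is less than or equal to $\mu_j$, if such an entry exists; otherwise the list stops. The number of local minima $\mathrm{lm}(\kappa)$ is the length $r$ of this list (and $0$ for the empty composition). *)

(* Defs.v *)
From HB Require Import structures.
From mathcomp Require Import all_boot all_order all_algebra.
From mathcomp Require Import finmap multiset.
From mathcomp Require Import boolp classical_sets cardinality fsbigop.

Set Implicit Arguments.
Unset Strict Implicit.
Unset Printing Implicit Defensive.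

Import GRing.Theory.
Local Open Scope ring_scope.
Local Open Scope classical_set_scope.
Local Open Scope mset_scope.

(******************************************************************************)
(* Formal power series in commuting variables indexed by an arbitrary (maybe  *)
(* infinite) choiceType I. A monomial is a finite multiset of variables;      *)
(* mset0 is the monomial 1 and `+` is the product of monomials.               *)
(******************************************************************************)

Section SubMultisets.
Variable I : choiceType.
Implicit Types (m a b : {mset I}) (s : seq I).

(* The divisors of the monomial m, without repetition; see mem_msub. *)
Definition msub m : seq {mset I} :=
  undup (foldr (fun i ds => ds ++ [seq msetD [mset i] a | a <- ds])
               [:: mset0] (enum_mset m)).

Lemma mem_msub m a : (a \in msub m) = (a `<=` m)%mset.
Proof.
rewrite mem_undup -[in RHS](seq_mset_id m).
elim: (enum_mset m) a => [|i s IHs] a /=.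
  have -> : seq_mset [::] = mset0 :> {mset I}.
    by apply/msetP => j; rewrite mset_seqE mset0E.
  by rewrite inE msubset0.
rewrite mset_cons mem_cat IHs; apply/orP/idP => [[]|].
- move=> /msubsetP le_as; apply/msubsetP => j.
  by rewrite mset1DE (leq_trans (le_as j)) ?leq_addl.
- case/mapP => b; rewrite IHs => /msubsetP le_bs ->; apply/msubsetP => j.
  by rewrite !mset1DE leq_add2l.
move=> /msubsetP le_a; have [ai|ai] := boolP (i \in a); last first.
  left; apply/msubsetP => j; move: (le_a j); rewrite mset1DE.
  by have [->|//] := eqVneq j i; rewrite (eqP _ : a i = 0%N) // mset_eq0.
right; apply/mapP; exists (a `\ i)%mset; last by rewrite msetB1K.
rewrite IHs; apply/msubsetP => j; move: (le_a j).
by rewrite mset1DE msetB1E leq_subLR.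
Qed.

Lemma msub_uniq m : uniq (msub m). Proof. exact: undup_uniq. Qed.

Lemma msub0 : msub mset0 = [:: mset0].
Proof. by rewrite /msub enum_mset0. Qed.

Lemma perm_msubB m : perm_eq [seq (m `\` a)%mset | a <- msub m] (msub m).
Proof.
apply: uniq_perm (msub_uniq m) _ => [|b].
  rewrite map_inj_in_uniq ?msub_uniq // => a b.
  rewrite !mem_msub => am bm /(congr1 (msetB m)).
  by rewrite !msetBBK.
apply/mapP/idP => [[a _ ->]|]; rewrite mem_msub ?msubsetDl // => bm.
by exists (m `\` b)%mset; rewrite ?mem_msub ?msubsetDl ?msetBBK.
Qed.

Lemma perm_msubD m a : (a `<=` m)%mset ->
  perm_eq [seq (a `+` b)%mset | b <- msub (m `\` a)%mset]
          [seq c <- msub m | (a `<=` c)%mset].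
Proof.
move=> am; apply: uniq_perm; rewrite ?filter_uniq ?msub_uniq //.
  by rewrite map_inj_uniq ?msub_uniq //; exact: can_inj (msetDKB a).
move=> c; rewrite mem_filter mem_msub; apply/mapP/andP => [[b]|[ac cm]].
  rewrite mem_msub => bm ->; split; last by rewrite -(msetBDKC am) msetDS.
  by apply/msubsetP => i; rewrite msetE2 leq_addr.
by exists (c `\` a)%mset; rewrite ?msetBDKC // mem_msub msetSB.
Qed.

Lemma perm_msetD a b :
  perm_eq (enum_mset (a `+` b)%mset) (enum_mset a ++ enum_mset b).
Proof.
rewrite (_ : (a `+` b)%mset = seq_mset (enum_mset a ++ enum_mset b)).
  exact: perm_eq_seq_mset.
by apply/msetP => i; rewrite mset_seqE count_cat msetE2 !count_mem_mset.
Qed.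

Lemma size_msetD a b : size (a `+` b)%mset = (size a + size b)%N.
Proof. by rewrite (perm_size (perm_msetD a b)) size_cat. Qed.

Lemma size_msetB_lt m a : (a `<=` m)%mset -> a != mset0 ->
  (size (m `\` a)%mset < size m)%N.
Proof.
move=> am a0; rewrite -[in ltnRHS](msetBDKC am) size_msetD.
by rewrite -[ltnLHS]add0n ltn_add2r lt0n size_mset_eq0.
Qed.

End SubMultisets.

Section PowerSeries.
Variables (I : choiceType) (R : comUnitRingType).

Record fps := Fps { fcoef : {mset I} -> R }.

Implicit Types (f g h : fps) (m a b : {mset I}).

HB.instance Definition _ := gen_eqMixin fps.
HB.instance Definition _ := gen_choiceMixin fps.

Lemma fpsP f g : (forall m, fcoef f m = fcoef g m) <-> f = g.
Proof.
split=> [fg|-> //]; case: f g fg => [f] [g] /= fg.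
by congr Fps; apply/funext.
Qed.

Definition fps_zero := Fps (fun=> 0).
Definition fps_opp f := Fps (fun m => - fcoef f m).
Definition fps_add f g := Fps (fun m => fcoef f m + fcoef g m).

Fact fps_addA : associative fps_add.
Proof. by move=> f g h; apply/fpsP => m /=; rewrite addrA. Qed.
Fact fps_addC : commutative fps_add.
Proof. by move=> f g; apply/fpsP => m /=; rewrite addrC. Qed.
Fact fps_add0 : left_id fps_zero fps_add.
Proof. by move=> f; apply/fpsP => m /=; rewrite add0r. Qed.
Fact fps_addN : left_inverse fps_zero fps_opp fps_add.
Proof. by move=> f; apply/fpsP => m /=; rewrite addNr. Qed.

HB.instance Definition _ :=
  GRing.isZmodule.Build fps fps_addA fps_addC fps_add0 fps_addN.

(* The monomial a, as a power series. *)
Definition fps_mon a := Fps (fun m => (m == a)%:R).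

Definition fps_mul f g :=
  Fps (fun m => \sum_(a <- msub m) fcoef f a * fcoef g (m `\` a)).

Fact fps_mulC : commutative fps_mul.
Proof.
move=> f g; apply/fpsP => m /=.
rewrite -(perm_big _ (perm_msubB m)) big_map big_seq [RHS]big_seq.
by apply: eq_bigr => a; rewrite mem_msub => am; rewrite msetBBK // mulrC.
Qed.

Fact fps_mulA : associative fps_mul.
Proof.
move=> f g h; apply/fpsP => m /=.
transitivity (\sum_(a <- msub m) \sum_(c <- msub m | (a `<=` c)%mset)
   fcoef f a * (fcoef g (c `\` a) * fcoef h (m `\` c))).
  rewrite big_seq [RHS]big_seq; apply: eq_bigr => a; rewrite mem_msub => am.
  rewrite -[RHS]big_filter -(perm_big _ (perm_msubD am)) big_map mulr_sumr.
  by apply: eq_bigr => b _; rewrite msetDKB msetBDA.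
rewrite (exchange_big_dep xpredT) //= big_seq [RHS]big_seq.
apply: eq_bigr => c; rewrite mem_msub => cm; rewrite mulr_suml.
rewrite -big_filter (perm_big (msub c)) => [|/=].
  by apply: eq_bigr => a _; rewrite mulrA.
apply: uniq_perm; rewrite ?filter_uniq ?msub_uniq // => a.
rewrite mem_filter !mem_msub; have [ac|//] := boolP (a `<=` c)%mset.
by rewrite (msubset_trans ac cm).
Qed.

Fact fps_mul1 : left_id (fps_mon mset0) fps_mul.
Proof.
move=> f; apply/fpsP => m /=.
rewrite (bigD1_seq mset0) ?msub_uniq ?mem_msub ?msub0set //= eqxx mul1r msetB0.
by rewrite big1 ?addr0 // => a /negPf ->; rewrite mul0r.
Qed.

Fact fps_mulD : left_distributive fps_mul +%R.
Proof.
move=> f g h; apply/fpsP => m /=; rewrite -big_split /=.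
by apply: eq_bigr => a _; rewrite mulrDl.
Qed.

Fact fps_1neq0 : fps_mon mset0 != 0.
Proof.
apply/eqP => /fpsP /(_ mset0) /= /eqP.
by rewrite eqxx; apply/negP; exact: oner_neq0.
Qed.

HB.instance Definition _ := GRing.Zmodule_isComNzRing.Build fps
  fps_mulA fps_mulC fps_mul1 fps_mulD fps_1neq0.

Lemma fcoef0 m : fcoef 0 m = 0. Proof. by []. Qed.
Lemma fcoefN f m : fcoef (- f) m = - fcoef f m. Proof. by []. Qed.
Lemma fcoefD f g m : fcoef (f + g) m = fcoef f m + fcoef g m.
Proof. by []. Qed.
Lemma fcoefB f g m : fcoef (f - g) m = fcoef f m - fcoef g m.
Proof. by []. Qed.
Lemma fcoef1 m : fcoef 1 m = (m == mset0)%:R. Proof. by []. Qed.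
Lemma fcoefM f g m :
  fcoef (f * g) m = \sum_(a <- msub m) fcoef f a * fcoef g (m `\` a).
Proof. by []. Qed.

Lemma fcoefM0 f g : fcoef (f * g) mset0 = fcoef f mset0 * fcoef g mset0.
Proof. by rewrite fcoefM msub0 big_seq1 msetBxx. Qed.

Lemma fps_monD a b : fps_mon (a `+` b) = fps_mon a * fps_mon b.
Proof.
apply/fpsP => m; rewrite fcoefM /=; have [am|am] := boolP (a `<=` m)%mset.
  rewrite (bigD1_seq a) ?msub_uniq ?mem_msub //= eqxx mul1r.
  rewrite big1 ?addr0 => [|c /negPf ->]; last by rewrite mul0r.
  by rewrite -[in LHS](msetBDKC am) (inj_eq (can_inj (msetDKB a))).
rewrite big_seq big1 => [|c].
  case: eqP am => // -> /negP[].
  by apply/msubsetP => i; rewrite msetE2 leq_addr.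
rewrite mem_msub; case: eqP => [->|_ _]; last by rewrite mul0r.
by rewrite (negPf am).
Qed.

(* The inverse of a series with invertible constant term, by recursion on the *)
(* degree (n bounds the degree of m from above):                              *)
(*   (f^-1)_m = - f_1^-1 * \sum_(a | m, a != 1) f_a * (f^-1)_(m / a).         *)
Fixpoint fps_inv_rec f n m : R :=
  if n is n'.+1 then
    (fcoef f mset0)^-1 * ((m == mset0)%:R -
      \sum_(a <- msub m | a != mset0) fcoef f a * fps_inv_rec f n' (m `\` a))
  else 0.

Definition fps_unit : {pred fps} := fun f => fcoef f mset0 \is a GRing.unit.

Definition fps_inv f :=
  if f \in fps_unit then Fps (fun m => fps_inv_rec f (size m).+1 m) else f.

Fact fps_mulVf : {in fps_unit, left_inverse 1 fps_inv *%R}.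
Proof.
move=> f fU; rewrite mulrC; apply/fpsP => m.
have recE n b : (size b <= n)%N ->
    fps_inv_rec f n.+1 b = fps_inv_rec f (size b).+1 b.
  have [k] := ubnP (size b); elim: k n b => // k IHk n b /=.
  rewrite ltnS => bk bn; congr (_ * (_ - _)).
  rewrite big_seq_cond [RHS]big_seq_cond; apply: eq_bigr => a.
  rewrite mem_msub => /andP[ab a0]; congr (_ * _).
  have ltb := size_msetB_lt ab a0.
  case: n bn => [|n] bn; first by have := leq_trans ltb bn.
  case sb: (size b) => [|s]; first by rewrite sb in ltb.
  have lek : (size (b `\` a)%mset < k)%N by exact: leq_trans ltb bk.
  rewrite (IHk n) ?(IHk s) //; first by rewrite -ltnS -sb.
  by rewrite -ltnS (leq_trans ltb).
rewrite fcoefM fcoef1 /fps_inv fU (bigD1_seq mset0) ?msub_uniq //=; last first.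
  by rewrite mem_msub msub0set.
rewrite msetB0 mulrA divrr // mul1r -addrA; apply/eqP.
rewrite -subr_eq0 addrAC addrA subrr sub0r addrC subr_eq0; apply/eqP.
rewrite big_seq_cond [RHS]big_seq_cond; apply: eq_bigr => a.
rewrite mem_msub => /andP[am a0]; congr (_ * _).
have := size_msetB_lt am a0; case sm: (size m) => [//|s] lts.
by rewrite recE.
Qed.

Fact fps_unitPl f g : g * f = 1 -> f \in fps_unit.
Proof.
move=> /(congr1 (fun h => fcoef h mset0)); rewrite fcoefM0 fcoef1 eqxx => gf1.
by apply/unitrPr; exists (fcoef g mset0); rewrite mulrC.
Qed.

Fact fps_inv_out : {in [predC fps_unit], fps_inv =1 id}.
Proof. by move=> f /negPf fU; rewrite /fps_inv fU. Qed.

HB.instance Definition _ := GRing.ComNzRing_hasMulInverse.Build fps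
  fps_mulVf fps_unitPl fps_inv_out.

Lemma fps_unitE f : (f \is a GRing.unit) = (fcoef f mset0 \is a GRing.unit).
Proof. by []. Qed.

End PowerSeries.

Section InfiniteFamilies.
Variables (I : choiceType) (R : comUnitRingType).

Definition fps_var (i : I) : fps I R := fps_mon R [mset i].

(* The coefficientwise sum of the family F over D is meaningful when every    *)
(* monomial occurs in finitely many terms; each use below is shown summable.  *)
Definition fps_summable (J : choiceType) (D : set J) (F : J -> fps I R) :=
  forall m, finite_set [set j | D j /\ fcoef (F j) m != 0].

Definition fps_sum (J : choiceType) (D : set J) (F : J -> fps I R) : fps I R :=
  Fps (fun m => \sum_(j \in D) fcoef (F j) m).

(* P is the infinite product F 1 * F 2 * F 3 * ...: every coefficient of the  *)
(* partial products is eventually constant, equal to that of P.               *)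
Definition fps_infprod (F : nat -> fps I R) (P : fps I R) :=
  forall m, exists N, forall n, (N <= n)%N ->
    fcoef (\prod_(1 <= k < n.+1) F k) m = fcoef P m.

Lemma fps_varX i n : fps_var i ^+ n = fps_mon R (msetn n i).
Proof.
elim: n => [|n IHn]; first by rewrite msetn0.
rewrite exprS IHn -fps_monD; congr fps_mon; apply/msetP => j.
by rewrite mset1DE !msetnE; case: (j == i).
Qed.

Lemma fps_mon_neq0 a (m : {mset I}) : fcoef (fps_mon R a) m != 0 -> m = a.
Proof. by rewrite /=; case: (m =P a) => //; rewrite eqxx. Qed.

End InfiniteFamilies.

Definition compositions : set (seq nat) := [set kappa | all (ltn 0) kappa].

(* The local minima that follow a current local minimum mu. *)
Fixpoint local_minima_after (mu : nat) (s : seq nat) : seq nat :=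
  if s is k :: s' then
    if (k <= mu)%N then k :: local_minima_after k s'
    else local_minima_after mu s'
  else [::].

Definition local_minima (kappa : seq nat) : seq nat :=
  if kappa is k :: s then k :: local_minima_after k s else [::].

Definition lm (kappa : seq nat) : nat := size (local_minima kappa).

Section Series.
Variable R : comUnitRingType.

(* The variables x_1, x_2, ..., t are indexed by option nat: None is t and    *)
(* Some i is x_(i+1), so that xt_x k = x_k for k >= 1 (xt_x 0 is never used). *)
Definition xt_x (k : nat) : fps (option nat) R := fps_var R (Some k.-1).
Definition xt_t : fps (option nat) R := fps_var R None.

Definition xt_tail (k : nat) : fps (option nat) R :=
  fps_sum [set j | (k < j)%N] xt_x.

Definition xt_series : fps (option nat) R :=
  fps_sum compositions
    (fun kappa => xt_t ^+ lm kappa * \prod_(k <- kappa) xt_x k).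

Definition qzt_q : fps 'I_3 R := fps_var R (0 : 'I_3).
Definition qzt_z : fps 'I_3 R := fps_var R (1 : 'I_3).
Definition qzt_t : fps 'I_3 R := fps_var R (2 : 'I_3).

Definition qzt_series : fps 'I_3 R :=
  fps_sum compositions
    (fun kappa => qzt_t ^+ lm kappa * qzt_q ^+ sumn kappa * qzt_z ^+ size kappa).

Lemma xt_tail_summable k : fps_summable [set j | (k < j)%N] xt_x.
Proof.
move=> m; apply: (@sub_finite_set _ _ [set j | (k < j)%N /\ m = [mset Some j.-1]]).
  by move=> j [kj /fps_mon_neq0].
have [[j [kj mj]]|nj] := pselect (exists j, (k < j)%N /\ m = [mset Some j.-1]).
  apply: (@sub_finite_set _ _ [set j]); last exact: finite_set1.
  move=> i [ki]; rewrite mj => /(msetn_inj (ltn0Sn 0)) [] ji /=.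
  by rewrite -(ltn_predK ki) -ji (ltn_predK kj).
apply: (@sub_finite_set _ _ set0); last exact: finite_set0.
by move=> j Pj; case: nj; exists j.
Qed.

Lemma finite_bounded_seq N :
  finite_set [set s : seq nat | (size s <= N)%N /\ all (geq N) s].
Proof.
apply: (@sub_finite_set _ _
  [set [seq val i | i <- (u : seq 'I_N.+1)] | u in [set: N.-bseq 'I_N.+1]]).
  move=> s [sN /allP leN]; pose u := [seq (inord k : 'I_N.+1) | k <- s].
  have uN : (size u <= N)%N by rewrite size_map.
  exists (Bseq uN) => //=; rewrite -map_comp map_id_in // => k ks /=.
  by rewrite inordK // ltnS; exact: leN.
exact: finite_image.
Qed.

Lemma leq_sumn (s : seq nat) k : k \in s -> (k <= sumn s)%N.
Proof.
elim: s => //= a s IHs; rewrite inE => /predU1P[->|/IHs]; first exact: leq_addr.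
by move/leq_trans; apply; exact: leq_addl.
Qed.

Lemma size_sumn (s : seq nat) : all (ltn 0) s -> (size s <= sumn s)%N.
Proof.
by elim: s => //= a s IHs /andP[a0 /IHs]; rewrite -add1n; exact: leq_add.
Qed.

Lemma xt_series_summable : fps_summable compositions
  (fun kappa => xt_t ^+ lm kappa * \prod_(k <- kappa) xt_x k).
Proof.
move=> m; pose N := (\sum_(i <- enum_mset m) (odflt 0 i).+1)%N.
apply: sub_finite_set (finite_bounded_seq N) => s [sC].
have -> : \prod_(k <- s) xt_x k =
    fps_mon R (seq_mset [seq Some k.-1 | k <- s]).
  elim: s {sC} => [|k s IHs]; rewrite ?big_nil ?big_cons /=.
    congr fps_mon; apply/esym/msetP => i; by rewrite mset_seqE mset0E.
  by rewrite IHs mset_cons fps_monD.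
rewrite fps_varX -fps_monD => /fps_mon_neq0 mE.
have sN : (sumn s <= N)%N.
  rewrite /N mE (perm_big _ (perm_msetD _ _)) big_cat /=.
  rewrite (perm_big _ (perm_eq_seq_mset _)) big_map /= sumnE.
  rewrite (leq_trans _ (leq_addl _ _)) // leq_sum // => k _.
  exact: leqSpred.
split; first by rewrite (leq_trans (size_sumn sC)).
by apply/allP => k /leq_sumn /= ks; exact: leq_trans ks sN.
Qed.

Lemma qzt_series_summable : fps_summable compositions
  (fun kappa => qzt_t ^+ lm kappa * qzt_q ^+ sumn kappa * qzt_z ^+ size kappa).
Proof.
move=> m; apply: sub_finite_set (finite_bounded_seq (m 0)) => s [sC].
have -> : qzt_t ^+ lm s * qzt_q ^+ sumn s * qzt_z ^+ size s = fps_mon R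
    (msetn (lm s) (2 : 'I_3) `+` msetn (sumn s) 0 `+` msetn (size s) 1)%mset.
  by rewrite 2!fps_monD; congr (_ * _ * _); exact: fps_varX.
move=> /fps_mon_neq0 mE.
have sN : sumn s = m 0 by rewrite mE !msetE2 !msetnE /= add0n addn0.
split; first by rewrite -sN size_sumn.
by apply/allP => k /leq_sumn /= ks; rewrite -sN.
Qed.

End Series.

(* Main.v *)
(* Let S_k be the sum over the compositions whose letters all exceed k.       *)
(* Removing the last letter of a composition with minimum k + 1 gives         *)
(*   S_k - S_(k+1) = (S_k - S_(k+1)) tail_(k+1) + S_k t x_(k+1),              *)
(* so S_k is the factor of index k + 1 times S_(k+1), and S_0 is the partial  *)
(* product up to n times S_n. Summability makes every coefficient of S_n      *)
(* eventually that of 1. The argument works for arbitrary series x_k and t;   *)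
(* the second identity is the case x_k = z q^k, where                         *)
(* tail_k (1 - q) = z q^(k+1).                                                *)

Require Import Defs.
From HB Require Import structures.
From mathcomp Require Import all_boot all_order all_algebra.
From mathcomp Require Import finmap multiset.
From mathcomp Require Import boolp classical_sets functions cardinality fsbigop.
From mathcomp Require Import ring.

Set Implicit Arguments.
Unset Strict Implicit.
Unset Printing Implicit Defensive.

Import GRing.Theory.
Local Open Scope ring_scope.

(** The recursion for S_k is [above_rec]. It rests on [lm_rcons], which says when an appended letter
    is a local minimum, and on the Cauchy product [fps_sumM]. The passage to the limit is
    [fcoef_above], and [compositions_infprod] joins the two. For x_k = z q^k, [qzt_tail] evaluates
    the tails and [geometric_factor] cancels the common factor 1 - q. *)

(** * Sums of summable families of power series *)

Section Summation.
Local Open Scope mset_scope.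
Local Open Scope classical_set_scope.
Variables (I : choiceType) (R : comUnitRingType).
Implicit Types (J K L : choiceType) (m a : {mset I}).

Lemma fps_summableS J (D E : set J) (F : J -> fps I R) :
  D `<=` E -> fps_summable E F -> fps_summable D F.
Proof. by move=> DE EF m; apply: sub_finite_set (EF m) => j [/DE]. Qed.

Lemma eq_fps_sum J (D : set J) (F G : J -> fps I R) :
  (forall j, D j -> F j = G j) -> fps_sum D F = fps_sum D G.
Proof.
by move=> FG; apply/fpsP => m; apply: eq_fsbigr => j /set_mem /FG ->.
Qed.

Lemma fps_sum1 J (j : J) (F : J -> fps I R) : fps_sum [set j] F = F j.
Proof. by apply/fpsP => m; rewrite /= fsbig_set1. Qed.

Lemma fps_summable1 J (j : J) (F : J -> fps I R) : fps_summable [set j] F.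
Proof. by move=> m; apply: sub_finite_set (finite_set1 j) => i []. Qed.

Lemma fps_sum_image J K (D : set J) (h : J -> K) (F : K -> fps I R) :
  set_inj D h -> fps_sum (h @` D) F = fps_sum D (F \o h).
Proof. by move=> hI; apply/fpsP => m; exact: fsbig_image. Qed.

(** A monomial has finitely many divisors, so a single finite list serves all of them. This suits
    products, whose coefficient at [m] involves only divisors of [m]. *)
Lemma fps_summable_bound J (D : set J) (F : J -> fps I R) m :
    fps_summable D F ->
  exists r : seq J, [/\ uniq r, {in r, forall j, D j} &
    forall a j, (a `<=` m)%mset -> D j -> j \notin r -> fcoef (F j) a = 0].
Proof.
move=> DF.
pose S := \bigcup_(a in [set` msub m]) [set j | D j /\ fcoef (F j) a != 0].
have Sfin : finite_set S by apply: bigcup_finite => [|a _]; [exact: finite_seq|].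
exists (fset_set S); split=> [|j|a j am Dj].
- exact: fset_uniq.
- by rewrite in_fset_set // => /set_mem [a _ []].
rewrite in_fset_set // => /negP jS; apply/eqP/negPn/negP => Fj0; apply: jS.
by apply/mem_set; exists a => //=; rewrite mem_msub.
Qed.

Lemma fcoef_sum_seq J (D : set J) (F : J -> fps I R) m (r : seq J) :
    uniq r -> {in r, forall j, D j} ->
    (forall j, D j -> j \notin r -> fcoef (F j) m = 0) ->
  fcoef (fps_sum D F) m = \sum_(j <- r) fcoef (F j) m.
Proof.
move=> r_uniq rD r0; rewrite /= (@fsbigE _ _ _ _ D r) //.
rewrite big_seq_cond [RHS]big_seq; apply: eq_bigl => j.
by case: (boolP (j \in r)) => //= /rD Dj; rewrite mem_set.
Qed.

(** At each monomial [m] both families can be cut down to finite lists valid for every divisor of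
    [m]; what remains is an exchange of finite sums. *)
Lemma fps_sumM J K (D : set J) (E : set K) (F : J -> fps I R)
    (G : K -> fps I R) : fps_summable D F -> fps_summable E G ->
  fps_sum D F * fps_sum E G = fps_sum (D `*` E) (fun p => F p.1 * G p.2).
Proof.
move=> DF EG; apply/fpsP => m.
have [r [r_uniq rD r0]] := fps_summable_bound m DF.
have [s [s_uniq sE s0]] := fps_summable_bound m EG.
rewrite (@fcoef_sum_seq _ _ _ _ [seq (i, j) | i <- r, j <- s]); first last.
- case=> i j [/= Di Ej] ij; rewrite big_seq big1 // => a; rewrite mem_msub => am.
  have [ir|ir] := boolP (i \in r); last by rewrite r0 ?mul0r.
  have js : j \notin s.
    by apply: contra ij => js; apply/allpairsP; exists (i, j).
  by rewrite [fcoef (G j) _]s0 ?mulr0 ?msubsetDl.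
- by move=> p /allpairsP [[i j]] [/= /rD ? /sE ? ->].
- by rewrite allpairs_uniq // => -[? ?] [? ?].
rewrite big_allpairs fcoefM.
under [RHS]eq_bigr do rewrite exchange_big.
rewrite [RHS]exchange_big big_seq [RHS]big_seq; apply: eq_bigr => a.
rewrite mem_msub => am; rewrite (fcoef_sum_seq r_uniq) //; last first.
  by move=> j; exact: r0.
rewrite (fcoef_sum_seq s_uniq) //; last by move=> j; apply: s0; exact: msubsetDl.
by rewrite mulr_suml; apply: eq_bigr => i _; rewrite mulr_sumr.
Qed.

Lemma fps_sumU J (D E : set J) (F : J -> fps I R) :
    fps_summable D F -> fps_summable E F -> D `&` E `<=` set0 ->
  fps_sum (D `|` E) F = fps_sum D F + fps_sum E F.
Proof.
move=> DF EF DE0; apply/fpsP => m.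
have [r [r_uniq rD r0]] := fps_summable_bound m DF.
have [s [s_uniq sE s0]] := fps_summable_bound m EF.
rewrite fcoefD [fcoef (fps_sum D F) m](fcoef_sum_seq r_uniq) //; last first.
  by move=> j; exact: (r0 _ _ (msubset_refl m)).
rewrite [fcoef (fps_sum E F) m](fcoef_sum_seq s_uniq) //; last first.
  by move=> j; exact: (s0 _ _ (msubset_refl m)).
rewrite (@fcoef_sum_seq _ _ _ _ (r ++ s)) ?big_cat //.
- rewrite cat_uniq r_uniq s_uniq andbT /=; apply/hasPn => j /sE Ej.
  by apply/negP => /rD Dj; exact: (DE0 j).
- by move=> j; rewrite mem_cat => /orP [/rD|/sE]; [left|right].
move=> j + /[!mem_cat] /norP [jr js].
have mm := msubset_refl m.
by case=> [Dj|Ej]; [exact: (r0 m)|exact: (s0 m)].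
Qed.

Lemma fps_var_const0 (i : I) : fcoef (fps_var R i) mset0 = 0.
Proof.
rewrite /=; case: eqP => // /msetP /(_ i).
by rewrite mset0E msetnxx.
Qed.

Lemma fps_1B_unit (f : fps I R) :
  fcoef f mset0 = 0 -> 1 - f \is a GRing.unit.
Proof. by move=> f0; rewrite fps_unitE fcoefB f0 subr0 fcoef1 eqxx unitr1. Qed.

End Summation.

(** * Compositions, local minima and the product formula *)

(** The last local minimum is the least letter of [s], so [j] becomes a new one exactly when no
    letter of [s] is smaller. For empty [s] the condition is vacuous and the first letter counts. *)
Lemma lm_rcons (s : seq nat) (j : nat) :
  lm (rcons s j) = (lm s + all (leq j) s)%N.
Proof.
have after mu u : size (local_minima_after mu (rcons u j)) =
    (size (local_minima_after mu u) + all (leq j) (mu :: u))%N.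
  elim: u mu => [|k u IHu] mu /=; first by rewrite andbT; case: leqP.
  case: leqP => [le_kmu|lt_muk] /=; rewrite IHu ?addSn /=.
    case: (leqP j k) => [jk|]; last by rewrite andbF.
    by rewrite (leq_trans jk).
  by case: (leqP j mu) => //= jmu; rewrite (leq_trans jmu (ltnW lt_muk)).
by case: s => // k s; rewrite /lm /= after addSn.
Qed.

Section Compositions.
Local Open Scope mset_scope.
Local Open Scope classical_set_scope.
Variables (I : choiceType) (R : comUnitRingType).
Variables (t : fps I R) (x : nat -> fps I R).

Let weight (s : seq nat) := t ^+ lm s * \prod_(k <- s) x k.
Let above k : set (seq nat) := [set s | all (ltn k) s].
Let tail k := fps_sum [set j | (k < j)%N] x.

Hypothesis x_summable : fps_summable [set j | (0 < j)%N] x.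
Hypothesis weight_summable : fps_summable compositions weight.
Hypothesis x_const0 : forall k, fcoef (x k) mset0 = 0.

Lemma above_summable k : fps_summable (above k) weight.
Proof.
apply: fps_summableS weight_summable => s /= /allP sk; apply/allP => j /sk.
exact: leq_ltn_trans.
Qed.

Lemma tail_summable k : fps_summable [set j | (k < j)%N] x.
Proof. by apply: fps_summableS x_summable => j; exact: leq_ltn_trans. Qed.

Lemma weight_rcons s j :
  weight (rcons s j) = weight s * (t ^+ all (leq j) s * x j).
Proof. by rewrite /weight lm_rcons big_rcons /= exprD; ring. Qed.

(* Deleting the last letter of a composition with minimum k + 1 leaves either *)
(* a composition with minimum k + 1 (last letter > k + 1) or an arbitrary     *)
(* composition with all letters > k (last letter k + 1, a local minimum).     *)
Lemma above_rec k :
  fps_sum (above k) weight * (1 - tail k.+1 - t * x k.+1) =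
  fps_sum (above k.+1) weight * (1 - tail k.+1).
Proof.
pose E : set (seq nat) := [set s | all (ltn k) s /\ k.+1 \in s].
pose app (p : seq nat * nat) := rcons p.1 p.2.
have appI (D : set (seq nat * nat)) : set_inj D app.
  by move=> [s i] [s' j] _ _ /= /rcons_inj [-> ->].
have E_summable : fps_summable E weight.
  by apply: fps_summableS (@above_summable k) => s [].
have splitC : above k = above k.+1 `|` E.
  apply/seteqP; split=> s /=.
    move=> sk; have [ks|ks] := boolP (k.+1 \in s); first by right.
    left; apply/allP => j js; have /= kj := allP sk _ js.
    by rewrite /= ltn_neqAle kj andbT; apply: contraNneq ks => ->.
  by case=> [/allP sk|[]//]; apply/allP => j /sk /ltnW.
(* If the last letter exceeds k + 1, the required letter k + 1 must occur before it. *)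
have splitE : E = app @` (E `*` [set j | (k.+1 < j)%N])
                  `|` app @` (above k `*` [set k.+1]).
  apply/seteqP; split=> s /=.
    case; case/lastP: s => // s j; rewrite all_rcons mem_rcons inE.
    move=> /andP [/= kj sk] kjs; have [->|kj'] := eqVneq j k.+1.
      by right; exists (s, k.+1).
    left; exists (s, j) => //=; rewrite ltn_neqAle eq_sym kj' kj; split=> //.
    by split=> //; move: kjs; rewrite eq_sym (negPf kj').
  case=> -[[s' j]] /= [].
    case=> sk ks kj <-; rewrite /app /= /E /= all_rcons sk mem_rcons inE ks orbT.
    by rewrite andbT; split=> //; exact: ltnW.
  by move=> sk -> <-; rewrite /app /E /= all_rcons /= leqnn sk mem_rcons inE eqxx.
have sumC : fps_sum (above k) weight =
    fps_sum (above k.+1) weight + fps_sum E weight.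
  rewrite splitC fps_sumU //; first exact: above_summable.
  by move=> s [/= /allP sk [_ /sk /=]]; rewrite ltnn.
have sumE : fps_sum E weight =
    fps_sum E weight * tail k.+1 + fps_sum (above k) weight * (t * x k.+1).
  (* The single term becomes a sum over a singleton, so that [fps_sumM] applies to both products. *)
  rewrite -(fps_sum1 k.+1 (fun j => t * x j)).
  rewrite !fps_sumM; first last; try exact: E_summable;
    try exact: tail_summable; try exact: above_summable;
    try exact: fps_summable1.
  rewrite [in LHS]splitE fps_sumU.
  - rewrite !fps_sum_image //; congr (_ + _); apply: eq_fps_sum => -[s j] /= [].
      case=> sk ks kj; rewrite weight_rcons; case: allP => [/(_ _ ks)|_].
        by rewrite leqNgt kj.
      by rewrite mul1r.
    by move=> sk ->; rewrite weight_rcons (_ : all _ _ = true).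
  - by apply: fps_summableS E_summable; rewrite [in X in _ `<=` X]splitE; left.
  - by apply: fps_summableS E_summable; rewrite [in X in _ `<=` X]splitE; right.
  move=> s [[[s1 j1] [/= _ kj1] <-]] [[s2 j2] [/= _ ->]].
  by move=> /rcons_inj [_ j1E]; move: kj1; rewrite -j1E ltnn.
(* Once the sum over [E] is read as S_k - S_(k+1), the difference of the two sides of the goal is
   that of [sumE]. *)
have /eqP := sumE; rewrite -subr_eq0 => /eqP sumE0.
apply/eqP; rewrite -subr_eq0; apply/eqP.
rewrite -[RHS]sumE0 sumC; ring.
Qed.

Lemma factor_unit k : 1 - tail k - t * x k \is a GRing.unit.
Proof.
rewrite -addrA -opprD; apply: fps_1B_unit.
by rewrite fcoefD fcoefM0 x_const0 mulr0 addr0 /= fsbig1.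
Qed.

(** Only finitely many compositions contribute to divisors of [m]. Beyond all their letters, only
    the empty composition is left, with weight 1. *)
Lemma fcoef_above m : exists N, forall n a, (N <= n)%N -> (a `<=` m)%mset ->
  fcoef (fps_sum (above n) weight) a = fcoef 1 a.
Proof.
have [r [r_uniq _ r0]] := fps_summable_bound m weight_summable.
(* The total of all letters occurring in [r] bounds each of them. *)
exists (sumn (flatten r)) => n a rn am.
rewrite (_ : 1 = weight [::]); last by rewrite /weight big_nil mulr1.
rewrite -(fps_sum1 [::] weight) /=.
apply/esym/fsbig_widen => [s ->//|s [/= sn s_neq0]].
apply: r0 => //; first by apply: sub_all sn => j /=; exact: leq_ltn_trans.
case: s sn s_neq0 => //= k s /andP [nk _] _; apply/negP => sr.
have /leq_sumn : k \in flatten r.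
  by apply/flattenP; exists (k :: s); rewrite ?mem_head.
by rewrite leqNgt (leq_ltn_trans rn nk).
Qed.

Lemma compositions_infprod :
  fps_infprod (fun k => (1 - tail k) / (1 - tail k - t * x k))
    (fps_sum compositions weight).
Proof.
move=> m; have [N above1] := fcoef_above m; exists N => n Nn.
(* Telescoping; the induction starts because [above 0] is [compositions] by definition. *)
have -> : fps_sum compositions weight =
    (\prod_(1 <= k < n.+1) ((1 - tail k) / (1 - tail k - t * x k))) *
    fps_sum (above n) weight.
  elim: n {Nn} => [|n IHn]; first by rewrite big_geq // mul1r.
  rewrite big_nat_recr //= IHn -mulrA; congr (_ * _).
  by rewrite mulrAC [_ * fps_sum _ _]mulrC -above_rec mulrK ?factor_unit.
(* With both sides as multiples of the partial product, it suffices that S_n and 1 agree on the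
   divisors of [m]. *)
rewrite -[in LHS](mulr1 (\prod_(_ <= _ < _) _)) !fcoefM.
rewrite big_seq [RHS]big_seq; apply: eq_bigr => a _.
by rewrite above1 // msubsetDl.
Qed.

End Compositions.

(** * The specialization x_k = z q^k *)

Lemma prod_geometric (A : comNzRingType) (q z : A) (s : seq nat) :
  \prod_(k <- s) (z * q ^+ k) = q ^+ sumn s * z ^+ size s.
Proof.
elim: s => [|k s IHs] /=; first by rewrite big_nil mulr1.
by rewrite big_cons IHs exprD exprS; ring.
Qed.

Lemma geometric_factor (A : comUnitRingType) (q z t T : A) k :
    1 - q \is a GRing.unit -> 1 - T - t * (z * q ^+ k) \is a GRing.unit ->
    T * (1 - q) = z * q ^+ k.+1 ->
  (1 - q - z * q ^+ k.+1) / (1 - q - z * q ^+ k.+1 + q ^+ k * (q - 1) * z * t) =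
  (1 - T) / (1 - T - t * (z * q ^+ k)).
Proof.
move=> q_unit b_unit <-; have -> : 1 - q - T * (1 - q) = (1 - T) * (1 - q) by ring.
have -> : (1 - T) * (1 - q) + q ^+ k * (q - 1) * z * t =
    (1 - T - t * (z * q ^+ k)) * (1 - q) by ring.
by rewrite invrM // [LHS]mulrA (mulrK q_unit).
Qed.

Section GeometricWeights.
Local Open Scope mset_scope.
Local Open Scope classical_set_scope.
Variable R : comUnitRingType.
Local Notation q := (qzt_q R).
Local Notation z := (qzt_z R).

Let x k := z * q ^+ k.

Lemma qzt_x_summable k : fps_summable [set j | (k <= j)%N] x.
Proof.
(* [m 0] is the exponent of q in [m], which determines the index j of z q^j. *)
move=> m; apply: sub_finite_set (finite_set1 (m 0)) => j [_].
rewrite /x fps_varX -fps_monD => /fps_mon_neq0 -> /=.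
by rewrite msetE2 !msetnE.
Qed.

(** Multiplication by q shifts the tail by one index, so the tail T satisfies T = z q^k + T q. *)
Lemma qzt_tail k :
  fps_sum [set j | (k <= j)%N] x * (1 - q) = z * q ^+ k.
Proof.
have shift : fps_sum [set j | (k < j)%N] x = fps_sum [set j | (k <= j)%N] x * q.
  (* Here q is viewed as a sum over a one-point set, to multiply termwise by [fps_sumM]. *)
  rewrite -(fps_sum1 tt (fun=> q)) fps_sumM; last 2 first.
  - exact: qzt_x_summable.
  - exact: fps_summable1.
  have -> : [set j | (k < j)%N] =
      (fun p : nat * unit => p.1.+1) @` ([set j | (k <= j)%N] `*` [set tt]).
    apply/seteqP; split=> [[//|j] kj|j [[i []] [/= ki _] <-]]; last exact: ki.
    by exists (j, tt).
  rewrite fps_sum_image => [|[i []] [j []] _ _ /= [->]//].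
  by apply: eq_fps_sum => -[j u] _ /=; rewrite /x exprSr mulrA.
have rec : fps_sum [set j | (k <= j)%N] x =
    z * q ^+ k + fps_sum [set j | (k <= j)%N] x * q.
  rewrite -shift (_ : [set j | (k <= j)%N] = [set k] `|` [set j | (k < j)%N]).
    rewrite fps_sumU ?fps_sum1 //.
    - exact: fps_summable1.
    - exact: (@qzt_x_summable k.+1).
    by move=> j [/= ->]; rewrite ltnn.
  apply/seteqP; split=> j /=; last by case=> [->|/ltnW].
  by rewrite leq_eqVlt => /predU1P [->|]; [left|right].
move: rec; generalize q z (fps_sum [set j | (k <= j)%N] x) => q' z' S rec.
by rewrite mulrBr mulr1 {1}rec addrK.
Qed.

Lemma qzt_seriesE : qzt_series R =
  fps_sum compositions (fun s => qzt_t R ^+ lm s * \prod_(k <- s) x k).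
Proof.
rewrite /qzt_series; congr fps_sum; apply/funext => s.
by rewrite prod_geometric mulrA.
Qed.

End GeometricWeights.

Theorem theorem23 (R : comUnitRingType) :
  (let x := xt_x R in let t := xt_t R in let tail := xt_tail R in
   fps_infprod
     (fun k => (1 - tail k) / (1 - tail k - t * x k))
     (xt_series R)) /\
  (let q := qzt_q R in let z := qzt_z R in let t := qzt_t R in
   fps_infprod
     (fun k => (1 - q - z * q ^+ k.+1) /
               (1 - q - z * q ^+ k.+1 + q ^+ k * (q - 1) * z * t))
     (qzt_series R)).
Proof.
split=> [x t tail|q z t].
  apply: compositions_infprod.
  - exact: xt_tail_summable.
  - exact: xt_series_summable.
  by move=> k; exact: fps_var_const0.
pose x k := z * q ^+ k.
pose tail k := fps_sum [set j | (k < j)%N] x.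
have x0 k : fcoef (x k) mset0 = 0 by rewrite fcoefM0 fps_var_const0 mul0r.
rewrite qzt_seriesE.
rewrite (_ : (fun k => _ / _) =
    fun k => (1 - tail k) / (1 - tail k - t * x k)).
  apply: compositions_infprod => //; first exact: qzt_x_summable.
  move=> m; have := qzt_series_summable R m.
  by under eq_fun do rewrite -mulrA -prod_geometric.
apply/funext => k; apply: geometric_factor.
- exact/fps_1B_unit/fps_var_const0.
- exact: (factor_unit t x0).
exact: qzt_tail.
Qed.
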